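(* Let $S\subseteq\mathbb{R}^n$ be a non-empty set with $0\in S$, let $f:S\to\mathbb{R}^n$ be locally Lipschitz with $f(0)=0$, and let $h:S\to\mathbb{R}^k$ be continuous with $h(0)=0$. Assume that the system $\dot x=f(x)$, $x\in S$, is forward complete, and consider it with output $y=h(x)$. Let $\Omega\subseteq S$ be a positively invariant set for $\dot x=f(x)$ with $0\in\Omega$. Suppose that there exist a function $a\in K_\infty$, functions $V,W\in C^1(\Omega;\mathbb{R}_+)$ with $\sup\{V(x)+W(x):x\in\Omega,\ |x|\le s\}<+\infty$ for all $s\ge 0$, and a continuous, positive definite function $\rho:\mathbb{R}_+\to\mathbb{R}_+$ such that for all $x\in\Omega$: $$\nabla V(x)f(x)\le-\rho(W(x)),\qquad a(|h(x)|)\le W(x),\qquad \nabla W(x)f(x)\le 0 .$$ Then the system $\dot x=f(x)$ with output $y=h(x)$ is Uniformly Asymptotically Output Stable (UAOS) on $\Omega$.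
   Context: $\mathbb{R}_+=[0,+\infty)$; $|\cdot|$ is the Euclidean norm; $B_R=\{x\in\mathbb{R}^n:|x|<R\}$. $K_\infty$ is the class of strictly increasing continuous functions $a:\mathbb{R}_+\to\mathbb{R}_+$ with $a(0)=0$ and $\lim_{s\to+\infty}a(s)=+\infty$. A function $\rho:\mathbb{R}_+\to\mathbb{R}_+$ is positive definite if $\rho(0)=0$ and $\rho(s)>0$ for $s>0$. Convention on $C^1$: for a set $A\subseteq\mathbb{R}^n$ lying between an open set and its closure, $C^1(A;\mathbb{R}_+)$ is the class of functions $A\to\mathbb{R}_+$ having continuous first-order derivatives in the interior of $A$ that can be continued continuously to all boundary points belonging to $A$. $\nabla V(x)=\left(\frac{\partial V}{\partial x_1}(x),\ldots,\frac{\partial V}{\partial x_n}(x)\right)$ (row vector). Forward complete: for every $x_0\in S$ the unique solution $x(t)=\phi(t,x_0)$ of $\dot x=f(x)$, $x(0)=x_0$, exists for all $t\ge0$ and satisfies $\phi(t,x_0)\in S$ for all $t\ge 0$. $\Omega$ is positively invariant if $\phi(t,x_0)\in\Omega$ for all $x_0\in\Omega$, $t\ge0$. Write $y(t,x_0)=h(\phi(t,x_0))$. The system is: - Lagrange output stable on $\Omega$ if for every $R>0$ the set $\{|y(t,x_0)|:x_0\in B_R\cap\Omega,\ t\ge0\}$ is bounded; - Lyapunov output stable on $\Omega$ if for every $\varepsilon>0$ there exists $\delta(\varepsilon)>0$ such that for all $x_0\in B_{\delta(\varepsilon)}\cap\Omega$ it holds that $|y(t,x_0)|\le\varepsilon$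 for all $t\ge0$; - UAOS on $\Omega$ if it is Lagrange and Lyapunov output stable on $\Omega$ and for every $\varepsilon,R>0$ there exists $T(\varepsilon,R)>0$ such that for all $x_0\in B_R\cap\Omega$ it holds that $|y(t,x_0)|\le\varepsilon$ for all $t\ge T(\varepsilon,R)$. *)

(* Defs.v *)
(* MathComp-Analysis.  Points of R^n are column vectors 'cV[R]_n; functions
   with a restricted domain are total functions of which only the values on
   that domain are ever constrained. *)
From HB Require Import structures.
From mathcomp Require Import all_boot all_order all_algebra.
From mathcomp Require Import all_classical all_reals all_analysis.

Set Implicit Arguments.
Unset Strict Implicit.
Unset Printing Implicit Defensive.

Import Order.TTheory GRing.Theory Num.Theory.
Import numFieldNormedType.Exports.

Local Open Scope classical_set_scope.
Local Open Scope ring_scope.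

(* The canonical norm `|x| of MathComp-Analysis on matrices is the sup norm;
   it induces the same topology and the same Lipschitz maps. *)
Definition enorm (R : realType) (n : nat) (x : 'cV[R]_n) : R :=
  Num.sqrt (\sum_(i < n) x i 0 ^+ 2).

Definition eball (R : realType) (n : nat) (r : R) : set 'cV[R]_n :=
  [set x | enorm x < r].

(* Nonnegativity on `[0, +oo[ follows from monotonicity and a 0 = 0. *)
Definition class_Kinfty (R : realType) (a : R -> R) : Prop :=
  [/\ {within `[0, +oo[, continuous a},
      {in `[0, +oo[ &, {homo a : s t / s < t}},
      a 0 = 0
    & a s @[s --> +oo] --> +oo].

Definition positive_definite (R : realType) (rho : R -> R) : Prop :=
  rho 0 = 0 /\ forall s, 0 < s -> 0 < rho s.

(* Differentiability at the endpoint t = 0 is one-sided. *)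
Definition is_solution (R : realType) (n : nat) (S : set 'cV[R]_n)
    (f : 'cV[R]_n -> 'cV[R]_n) (x0 : 'cV[R]_n) (x : R -> 'cV[R]_n) : Prop :=
  [/\ x 0 = x0,
      forall t : R, 0 <= t -> S (x t),
      e^-1 *: (x e - x 0) @[e --> 0^'+] --> f (x 0)
    & forall t : R, 0 < t -> is_derive t (1 : R) x (f (x t))].

Definition forward_complete (R : realType) (n : nat) (S : set 'cV[R]_n)
    (f : 'cV[R]_n -> 'cV[R]_n) : Prop :=
  forall x0, S x0 -> exists x, is_solution S f x0 x.

(* phi(t, x0).  For f locally Lipschitz on S, two solutions from the same
   initial point agree on `[0, +oo[, so the choice made by get is immaterial
   there. *)
Definition flow (R : realType) (n : nat) (S : set 'cV[R]_n)
    (f : 'cV[R]_n -> 'cV[R]_n) (t : R) (x0 : 'cV[R]_n) : 'cV[R]_n :=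
  (get [set x : R -> 'cV[R]_n | is_solution S f x0 x]) t.

Definition output (R : realType) (n k : nat) (S : set 'cV[R]_n)
    (f : 'cV[R]_n -> 'cV[R]_n) (h : 'cV[R]_n -> 'cV[R]_k)
    (t : R) (x0 : 'cV[R]_n) : 'cV[R]_k :=
  h (flow S f t x0).

Definition positively_invariant (R : realType) (n : nat) (S : set 'cV[R]_n)
    (f : 'cV[R]_n -> 'cV[R]_n) (Omega : set 'cV[R]_n) : Prop :=
  forall x0 t, Omega x0 -> 0 <= t -> Omega (flow S f t x0).

Definition between_open_and_closure (R : realType) (n : nat)
    (A : set 'cV[R]_n) : Prop :=
  exists U : set 'cV[R]_n, [/\ open U, U `<=` A & A `<=` closure U].

(* G is the row vector of first-order partial derivatives of V in the interior
   of A, and its continuous continuation at the boundary points in A. *)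
Definition is_gradient (R : realType) (n : nat) (A : set 'cV[R]_n)
    (V : 'cV[R]_n -> R) (G : 'cV[R]_n -> 'rV[R]_n) : Prop :=
  (forall (x : 'cV[R]_n) (i : 'I_n), A° x ->
     is_derive x (delta_mx i 0 : 'cV[R]_n) V (G x 0 i))
  /\ {within A, continuous G}.

(* C^1(A; R_+).  As the convention only concerns the derivatives, continuity
   of V itself at boundary points in A is not required. *)
Definition C1_nonneg (R : realType) (n : nat) (A : set 'cV[R]_n)
    (V : 'cV[R]_n -> R) : Prop :=
  [/\ between_open_and_closure A,
      forall x, A x -> 0 <= V x
    & exists G, is_gradient A V G].

(* A being contained in the closure of its interior, the continuation is
   unique: for V in C^1(A; R_+), grad A V is determined on A. *)
Definition grad (R : realType) (n : nat) (A : set 'cV[R]_n)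
    (V : 'cV[R]_n -> R) : 'cV[R]_n -> 'rV[R]_n :=
  get [set G : 'cV[R]_n -> 'rV[R]_n | is_gradient A V G].

Section output_stability.
Context (R : realType) (n k : nat) (S : set 'cV[R]_n).
Context (f : 'cV[R]_n -> 'cV[R]_n) (h : 'cV[R]_n -> 'cV[R]_k).
Context (Omega : set 'cV[R]_n).

Let y := output S f h.

Definition lagrange_output_stable : Prop :=
  forall r : R, 0 < r ->
    bounded_set [set v : R | exists x0 t,
      [/\ (eball r `&` Omega) x0, 0 <= t & v = enorm (y t x0)]].

Definition lyapunov_output_stable : Prop :=
  forall eps : R, 0 < eps -> exists2 delta : R, 0 < delta &
    forall x0 t, (eball delta `&` Omega) x0 -> 0 <= t ->
      enorm (y t x0) <= eps.

Definition UAOS : Prop :=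
  [/\ lagrange_output_stable,
      lyapunov_output_stable
    & forall eps r : R, 0 < eps -> 0 < r -> exists2 T : R, 0 < T &
        forall x0 t, (eball r `&` Omega) x0 -> T <= t ->
          enorm (y t x0) <= eps].

End output_stability.

(* Main.v *)
(* Membership in C^1(Omega) does not make V and W continuous at boundary points
   of Omega, so the Lyapunov inequalities are integrated only along trajectories
   in the interior of Omega.  For small times the flow is a 1/2-Lipschitz
   perturbation of the identity, hence an open map, so that interior points of
   Omega remain interior.  From an interior point, W is nonincreasing, and as
   long as W > a eps the nonnegative V decreases at a positive rate; this gives
   Lagrange stability and uniform attractivity, which extend to Omega by
   density and continuous dependence on initial conditions.  Lyapunov stability
   then follows from attractivity for large times and from continuous
   dependence at the equilibrium 0 for small times. *)
Require Import Defs.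
From HB Require Import structures.
From mathcomp Require Import all_boot all_order all_algebra.
From mathcomp Require Import all_classical all_reals all_analysis.
From mathcomp Require Import lra.
Import Order.TTheory GRing.Theory Num.Theory.
Import numFieldNormedType.Exports.
Local Open Scope classical_set_scope.
Local Open Scope ring_scope.

(** * Preliminaries *)

(** Completeness joined to the normed structure on matrices, so that the Banach fixed point theorem
    applies to column vectors. *)
HB.instance Definition _ (R : realType) (m n : nat) :=
  Complete.on 'M[R]_(m, n).

Lemma mx_norm_le {R : realType} {m n : nat} (x : 'M[R]_(m, n)) (c : R) :
  0 <= c -> (forall i j, `|x i j| <= c) -> `|x| <= c.
Proof.
move=> c0 xc; rewrite [leLHS]/Num.Def.normr /= mx_normrE.
by apply/bigmax_leP; split => // -[i j] _ /=.
Qed.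

Lemma coord_le_mx_norm {R : realType} {m n : nat} (x : 'M[R]_(m, n)) i j :
  `|x i j| <= `|x|.
Proof.
rewrite [leRHS]/Num.Def.normr /= mx_normrE.
exact: (le_bigmax _ (fun ij : 'I_m * 'I_n => `|x ij.1 ij.2|) (i, j)).
Qed.

(** Apply the step at the infimum of the failing times: [P] holds at some s at or just below it and
    would propagate to a failing time just above it. Letting s and s' lie on either side of t covers
    limit and successor steps at once. *)
Lemma local_real_induction {R : realType} {P : R -> Prop} :
  P 0 ->
  (forall t, 0 <= t -> exists2 e, 0 < e &
     forall s s', 0 <= s -> t - e < s -> s <= s' -> s' < t + e ->
       P s -> P s') ->
  forall t, 0 <= t -> P t.
Proof.
move=> P0 step t t0; apply: contrapT => nPt.
pose A := [set s | 0 <= s /\ ~ P s].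
have A0 : A !=set0 by exists t.
have Alb : has_lbound A by exists 0 => s [].
have infA0 : 0 <= inf A by apply: lb_le_inf => // s [].
have [e e0 He] := step _ infA0.
have Pbefore s : 0 <= s -> s < inf A -> P s.
  move=> s0 sA; apply: contrapT => nPs.
  by have := ge_inf Alb (conj s0 nPs : A s); rewrite leNgt sA.
have [s [s0 sA se Ps]] : exists s, [/\ 0 <= s, s <= inf A, inf A - e < s & P s].
  have [->|iA] := eqVneq (inf A) 0; first by exists 0; split => //; lra.
  (* This point is nonnegative and strictly below the infimum, so [P] holds there. *)
  exists (Num.max 0 (inf A - e / 2)); split.
  - by rewrite le_max lexx.
  - by rewrite ge_max infA0; lra.
  - by rewrite lt_max; apply/orP; right; lra.
  - apply: Pbefore; first by rewrite le_max lexx.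
    by rewrite gt_max lt_neqAle eq_sym iA infA0 /=; lra.
have [z [z0 nPz] zA] : exists2 z, A z & z < inf A + e.
  by apply/inf_adherent => //; split.
apply: nPz; have [zs|sz] := ltP z s.
  by apply: Pbefore => //; exact: lt_le_trans sA.
exact: (He s).
Qed.

(** The norm is the maximum over the entries, so the real mean value theorem on each entry loses no
    constant. *)
Lemma mx_mean_value {R : realType} {m n : nat} (X X' : R -> 'M[R]_(m, n))
    (a b M : R) :
  a <= b -> (forall t, a < t < b -> is_derive t (1 : R) X (X' t)) ->
  {within `[a, b], continuous X} ->
  (forall t, a < t < b -> `|X' t| <= M) ->
  `|X b - X a| <= M * (b - a).
Proof.
move=> ab dX cX X'M; move: ab; rewrite le_eqVlt => /predU1P[<-|ab].
  by rewrite !subrr normr0 mulr0.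
have M0 : 0 <= M.
  apply: le_trans (normr_ge0 (X' ((a + b) / 2))) (X'M _ _).
  by apply/andP; split; lra.
apply: mx_norm_le => [|i j]; first by apply: mulr_ge0 => //; lra.
have [||c cab] := @MVT R (fun t => X t i j) (fun t => X' t i j) a b ab.
- move=> t; rewrite in_itv /= => tab; have [dXt eXt] := dX _ tab.
  have /derivable_mxP/(_ i j) dXij := dXt.
  apply: DeriveDef => //.
  by rewrite -eXt derive_mx// mxE.
- move=> t; apply: (@continuous_comp (subspace `[a, b]) _ _ X (fun M : 'M[R]_(m, n) => M i j)).
    exact: cX.
  exact: coord_continuous.
rewrite !mxE => ->; rewrite normrM (ger0_norm (_ : 0 <= b - a)); last by lra.
apply: ler_wpM2r; first by lra.
apply: le_trans (coord_le_mx_norm _ _ _) (X'M _ _).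
by move: cab; rewrite in_itv.
Qed.

Lemma within_continuousP {R : realType} {U V : normedModType R} (A : set U)
    (g : U -> V) :
  {within A, continuous g} <->
  forall x, A x -> forall e : R, 0 < e -> exists2 d : R, 0 < d &
    forall y, A y -> `|y - x| < d -> `|g y - g x| < e.
Proof.
rewrite subspace_continuousP; split => gc x Ax.
- move=> e e0; have /cvgrPdist_lt/(_ _ e0) := gc _ Ax.
  rewrite /within /= => /nbhs_ballP[d /= d0 dg]; exists d => // y Ay yx.
  rewrite distrC; apply: dg => //.
  by rewrite -ball_normE /ball_ /= distrC.
- apply/cvgrPdist_lt => e e0; have [d d0 dg] := gc _ Ax _ e0.
  rewrite /within /=; apply/nbhs_ballP; exists d => //= y.
  rewrite -ball_normE /ball_ /= distrC => yx Ay.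
  by rewrite distrC; exact: dg.
Qed.

(** The map [T] is a 1/2-contraction whose fixed points solve [g x = y]. It preserves the closed
    ball, since [T q] is within r / 2 of q and contraction adds at most r / 2. *)
Lemma perturbed_id_surjective {R : realType} {V : completeNormedModType R}
    {q y : V} {g : V -> V} {r : R} :
  0 < r ->
  (forall x z, `|x - q| <= r -> `|z - q| <= r ->
     `|(g x - g z) - (x - z)| <= 2^-1 * `|x - z|) ->
  `|y - g q| <= r / 2 -> exists2 x, `|x - q| <= r & g x = y.
Proof.
move=> r0 g_lip yq; pose T x := y - (g x - x).
pose B := [set x : V | `|x - q| <= r].
have T_lip x z : B x -> B z -> `|T x - T z| <= 2^-1 * `|x - z|.
  move=> Bx Bz; rewrite (_ : T x - T z = - ((g x - g z) - (x - z))).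
    by rewrite normrN g_lip.
  by rewrite /T [- (y - _)]opprB addrC addrA subrK !opprB addrACA
    [g z + x]addrC addrACA.
have Bq : B q by rewrite /B /= subrr normr0 ltW.
have TB : {homo T : x / B x >-> B x}.
  move=> x Bx; rewrite /B /=.
  have := T_lip _ _ Bx Bq; have : `|T q - q| <= r / 2.
    rewrite (_ : T q - q = y - g q) //.
    by rewrite /T opprB addrCA [q + _]addrC addrK.
  have := ler_distD (T q) (T x) q; move: Bx; rewrite /B /=; lra.
have half0 : 0 <= 2^-1 :> R by lra.
have T_contr : is_contraction (mkfun_fun TB).
  exists (NngNum half0); split; first by rewrite /=; lra.
  by move=> [x z] [/= Bx Bz]; exact: T_lip.
have Bclosed : closed B.
  suff -> : B = closed_ball q r by exact: closed_ball_closed.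
  by rewrite closed_ballE//; apply/seteqP; split => x;
    rewrite /B /closed_ball_ /= distrC.
have [|x Bx xT] := banach_fixed_point T_contr Bclosed; first by exists q.
exists x => //; move/eqP: xT.
by rewrite /= /mkfun /T eq_sym subr_eq addrC subrK => /eqP.
Qed.

(** * Solutions and the flow *)

Section solutions.
Context {R : realType} {n : nat} {S : set 'cV[R]_n}.
Context {f : 'cV[R]_n -> 'cV[R]_n}.
Implicit Types (x y z : 'cV[R]_n) (X Y Z : R -> 'cV[R]_n).

Lemma solution_continuous {x X} :
  is_solution S f x X -> {within `[0, +oo[, continuous X}.
Proof.
case=> _ _ dX0 dX; apply/continuous_within_itvcyP; split.
  move=> t; rewrite in_itv /= andbT => t0.
  have [dXt _] := dX _ t0.
  by apply/differentiable_continuous/derivable1_diffP.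
(* Right continuity at 0: [X e] is recovered from its difference quotient, which converges. *)
have : X 0 + e *: (e^-1 *: (X e - X 0)) @[e --> 0^'+] --> X 0.
  rewrite -[X in _ --> X]addr0 -(scale0r (f (X 0))).
  apply: cvgD; first exact: cvg_cst.
  apply: cvgZ => //; apply: cvg_at_right_filter; exact: cvg_id.
apply: cvg_trans; apply: near_eq_cvg; near=> e.
have e0 : e != 0 by near: e; exact: nbhs_right_neq.
by rewrite scalerA mulfV// scale1r addrC subrK.
Unshelve. all: by end_near. Qed.

Lemma solution_shift {x X s} :
  is_solution S f x X -> 0 <= s ->
  is_solution S f (X s) (fun t => X (s + t)).
Proof.
move=> solX s0; have [X0 SX dX0 dX] := solX.
(* At s = 0 only a one-sided derivative is available; for s > 0 the two-sided one yields the right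
   derivative. *)
move: s0; rewrite le_eqVlt => /predU1P[<-|s0].
  rewrite (_ : (fun t => X (0 + t)) = X) ?X0 //.
  by apply/funext => t; rewrite add0r.
split => //=.
- by rewrite addr0.
- by move=> t t0; apply: SX; apply: addr_ge0 => //; exact: ltW.
- rewrite addr0; have [dXs eXs] := dX _ s0.
  have : h^-1 *: (X (h *: (1 : R) + s) - X s) @[h --> 0^'] --> f (X s).
    by rewrite -eXs; exact: dXs.
  move=> /cvg_dnbhs_at_right; apply: cvg_trans; apply: near_eq_cvg.
  by apply: nearW => h /=; rewrite scaler1 (addrC h).
- move=> t t0; have st0 : 0 < s + t by exact: addr_gt0.
  have [dXt eXt] := dX _ st0.
  have quot : (fun h : R => h^-1 *: (X (s + (h *: (1 : R) + t)) - X (s + t)))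
      = (fun h => h^-1 *: (X (h *: (1 : R) + (s + t)) - X (s + t))).
    by apply/funext => h; rewrite addrCA.
  apply: DeriveDef; first by rewrite /derivable quot.
  by rewrite -eXt /derive quot.
Unshelve. all: by end_near. Qed.
End solutions.

(** * Comparison of nearby solutions over a short time *)

Section local_estimate.
Context {R : realType} {n : nat} {S : set 'cV[R]_n}.
Context {f : 'cV[R]_n -> 'cV[R]_n}.
Hypothesis f_lip : [locally [lipschitz f x | x in S]].
Implicit Types (p x y z : 'cV[R]_n) (X Y Z : R -> 'cV[R]_n).

Lemma local_lipschitz_bound {p} : S p -> exists r L M : R, [/\ 0 < r, 0 < L, 0 < M,
  (forall x y, S x -> S y -> `|x - p| < r -> `|y - p| < r ->
     `|f x - f y| <= L * `|x - y|) &
  forall x, S x -> `|x - p| < r -> `|f x| <= M].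
Proof.
(* The Lipschitz bound is local on pairs of points; the diagonal pair gives it on a ball around
   p. *)
move=> Sp; have f_lip_p := f_lip (p, p) (conj Sp Sp).
near (pinfty_nbhs R) => L.
have L0 : 0 < L by near: L; exact: nbhs_pinfty_gt.
have fL : (L .-lipschitz_on f) (within (S `*` S) (nbhs (p, p))).
  by near: L; exact: f_lip_p.
move: fL; rewrite /dominated_by /within /= => /nbhs_ballP[r /= r0 rf].
have fL x y : S x -> S y -> `|x - p| < r -> `|y - p| < r ->
     `|f x - f y| <= L * `|x - y|.
  move=> Sx Sy xp yp; apply: (rf (x, y)) => //; split => /=;
    by rewrite -ball_normE /ball_ /= distrC.
exists r, L, (`|f p| + L * r + 1); split => //.
  by have := normr_ge0 (f p); have := mulr_gt0 L0 r0; lra.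
move=> x Sx xp; have := fL x p Sx Sp xp; rewrite subrr normr0 => /(_ r0) fxp.
have : `|f x| <= `|f x - f p| + `|f p| by rewrite -[in leLHS](subrK (f p) (f x)) ler_normD.
have : L * `|x - p| <= L * r by rewrite ler_pM2l// ltW.
lra.
Unshelve. all: by end_near. Qed.

Lemma solution_increment {x X a b M} : is_solution S f x X ->
  0 <= a -> a <= b -> (forall t, a <= t <= b -> `|f (X t)| <= M) ->
  `|X b - X a| <= M * (b - a).
Proof.
move=> solX a0 ab fM; have [_ _ _ dX] := solX.
apply: (@mx_mean_value _ _ _ X (fun t => f (X t))) => //.
- by move=> t /andP[at_ _]; apply: dX; exact: le_lt_trans at_.
- move: (solution_continuous solX); apply: continuous_subspaceW.
  by move=> t; rewrite /= !in_itv /= andbT => /andP[+ _]; exact: le_trans.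
- by move=> t /andP[at_ tb]; apply: fM; rewrite !ltW.
Qed.

(** A substitute for Gronwall's inequality: with [D] the difference of the solutions and w a maximum
    point of its norm, [D] drifts by at most L * tau times that maximum, hence by a quarter of it.
    The maximum is then at most 4/3 of the initial difference, and the drift at most 1/3 of it. *)
Lemma local_solution_estimate {p} : S p -> exists r tau : R, [/\ 0 < r, 0 < tau &
  forall x y X Y, is_solution S f x X -> is_solution S f y Y ->
    `|x - p| < r -> `|y - p| < r -> forall t, 0 <= t <= tau ->
    `|(X t - Y t) - (x - y)| <= 2^-1 * `|x - y|].
Proof.
move=> Sp; have [r [L [M [r0 L0 M0 fL fM]]]] := local_lipschitz_bound Sp.
(* The first bound limits the distance travelled to r / 4, the second makes L * tau at most 1/4. *)
pose tau := Num.min (r / (4 * M)) (4 * L)^-1.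
have tau0 : 0 < tau.
  by rewrite lt_min divr_gt0 ?invr_gt0 ?mulr_gt0.
have tauM : M * tau <= r / 4.
  have : tau <= r / (4 * M) by rewrite ge_min lexx.
  by rewrite ler_pdivlMr ?mulr_gt0//; lra.
have tauL : L * tau <= 1 / 4.
  have : tau <= (4 * L)^-1 by rewrite ge_min lexx orbT.
  by rewrite -[leRHS]mul1r ler_pdivlMr ?mulr_gt0//; lra.
(* The speed bound M holds only within r of p, so confinement to r / 2 is propagated in time. *)
have stay x X : is_solution S f x X -> `|x - p| < r / 4 ->
    forall t, 0 <= t -> t <= tau -> forall u, 0 <= u <= t -> `|X u - p| < r / 2.
  move=> solX xp; have [X0 SX _ _] := solX.
  apply: local_real_induction => [_ u|t t0].
    by rewrite -eq_le => /eqP <-; rewrite X0; lra.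
  have /within_continuousP/(_ t) := solution_continuous solX.
  have r8 : 0 < r / 8 by lra.
  rewrite /= in_itv /= andbT => /(_ t0 _ r8)[e e0 Xe].
  exists e => // s s' s0 tes ss' ste Ps s'tau u /andP[u0 us'].
  have stau : s <= tau by exact: le_trans s'tau.
  have near_p v : 0 <= v <= u -> `|X v - p| < r.
    move=> /andP[v0 vu]; have [vs|sv] := leP v s.
      by have := Ps stau v; rewrite v0 vs => /(_ isT); lra.
    (* Past s, continuity at t moves the solution by less than r / 4 from [X s], so it stays within
       3r / 4 of p. *)
    have Xv : `|X v - X t| < r / 8.
      by apply: Xe; [rewrite /= in_itv /= v0|rewrite ltr_norml; apply/andP; split; lra].
    have Xs : `|X s - X t| < r / 8.
      by apply: Xe; [rewrite /= in_itv /= s0|rewrite ltr_norml; apply/andP; split; lra].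
    have := Ps stau s; rewrite s0 lexx => /(_ isT) Xsp.
    have := ler_distD (X t) (X v) (X s); have := ler_distD (X s) (X v) p.
    by rewrite (distrC (X t) (X s)); lra.
  (* With the speed bounded by M up to u, integrating from time 0 restores the sharper radius r /
     2. *)
  have : `|X u - X 0| <= M * (u - 0).
    apply: (solution_increment solX) => // v /andP[v0 vu].
    by apply: fM; [exact: SX|apply: near_p; rewrite v0].
  have : M * u <= M * tau by rewrite ler_pM2l//; lra.
  by have := ler_distD (X 0) (X u) p; rewrite X0; lra.
exists (r / 4), tau; split=> //; first by lra.
move=> x y X Y solX solY xp yp t /andP[t0 ttau].
have [X0 SX _ dX] := solX; have [Y0 SY _ dY] := solY.
pose D u := X u - Y u.
have cD : {within `[0, tau], continuous D}.
  have cXY Z z : is_solution S f z Z -> {within `[0, tau], continuous Z}.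
    move=> /solution_continuous; apply: continuous_subspaceW.
    by move=> u; rewrite /= !in_itv /= andbT => /andP[].
  move=> u; apply: (@cvgB _ _ (subspace `[0, tau])).
    exact: cXY solX u.
  exact: cXY solY u.
have [|w wtau Dw] := @EVT_max R (fun u => `|D u|) 0 tau (ltW tau0).
  by move=> u; apply: cvg_norm; exact: cD.
move: wtau; rewrite in_itv /= => /andP[w0 wtau].
have DD u : 0 <= u <= tau -> `|D u - D 0| <= L * `|D w| * u.
  move=> /andP[u0 utau]; rewrite -[X in _ * X]subr0.
  apply: (@mx_mean_value _ _ _ D (fun v => f (X v) - f (Y v))) => //.
  - by move=> v /andP[v0 vu]; apply: is_deriveB; [exact: dX|exact: dY].
  - move: cD; apply: continuous_subspaceW.
    move=> v; rewrite /= !in_itv /= => /andP[-> vu] /=; lra.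
  - move=> v /andP[v0 vu]; have v0' := ltW v0; have vtau : v <= tau by lra.
    apply: (@le_trans _ _ (L * `|D v|)).
      have Xv : `|X v - p| < r / 2 by apply: (stay _ _ solX xp v) => //; rewrite v0' lexx.
      have Yv : `|Y v - p| < r / 2 by apply: (stay _ _ solY yp v) => //; rewrite v0' lexx.
      by apply: fL; [exact: SX|exact: SY|lra|lra].
    by rewrite ler_pM2l//; apply: Dw; rewrite in_itv /= v0'.
have LD u : 0 <= u <= tau -> L * `|D w| * u <= `|D w| / 4.
  move=> /andP[u0 utau]; rewrite mulrAC mulrC.
  apply: ler_wpM2l => //; apply: le_trans (_ : L * tau <= _).
    by rewrite ler_pM2l.
  by lra.
have wle : `|D w| <= `|D 0| + `|D w| / 4.
  have := DD w; have := LD w; rewrite w0 wtau => /(_ isT) + /(_ isT).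
  have := ler_normD (D w - D 0) (D 0); rewrite subrK; lra.
have := DD t; have := LD t; rewrite t0 ttau => /(_ isT) + /(_ isT).
by move: wle; rewrite /D X0 Y0; have := normr_ge0 (x - y); lra.
Qed.
End local_estimate.

(** * Uniqueness, continuous dependence and invariance of the interior *)

Section flow_properties.
Context {R : realType} {n : nat} {S : set 'cV[R]_n}.
Context {f : 'cV[R]_n -> 'cV[R]_n}.
Hypothesis f_lip : [locally [lipschitz f x | x in S]].
Implicit Types (p x y z : 'cV[R]_n) (X Y Z : R -> 'cV[R]_n).

(** The local estimate at [X t] serves all base points [X s] with s near t, with a common radius and
    time span; the step of [local_real_induction] needs this uniformity. *)
Lemma estimate_along_solution {x X t} : is_solution S f x X -> 0 <= t ->
  exists r e : R, [/\ 0 < r, 0 < e & forall s s', 0 <= s ->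
    t - e < s -> s <= s' -> s' < t + e ->
    forall y z Y Z, is_solution S f y Y -> is_solution S f z Z ->
      `|y - X s| < r -> `|z - X s| < r ->
      `|(Y (s' - s) - Z (s' - s)) - (y - z)| <= 2^-1 * `|y - z|].
Proof.
move=> solX t0; have [_ SX _ _] := solX.
have [r [tau [r0 tau0 est]]] := local_solution_estimate f_lip (SX t t0).
have r2 : 0 < r / 2 by lra.
have /within_continuousP/(_ t) := solution_continuous solX.
rewrite /= in_itv /= andbT => /(_ t0 _ r2)[d d0 Xd].
(* Half of tau keeps the elapsed time s' - s below tau; d keeps [X s] within r / 2 of [X t]. *)
pose e := Num.min d (tau / 2).
have [ed etau] : e <= d /\ e <= tau / 2 by rewrite /e !ge_min !lexx orbT.
exists (r / 2), e; split => //; first by rewrite lt_min d0; lra.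
move=> s s' s0 tes ss' ste y z Y Z solY solZ yX zX.
have Xs : `|X s - X t| < r / 2.
  apply: Xd; first by rewrite /= in_itv /= s0.
  by rewrite ltr_norml; apply/andP; split; lra.
apply: (est _ _ _ _ solY solZ).
- by have := ler_distD (X s) y (X t); lra.
- by have := ler_distD (X s) z (X t); lra.
- by apply/andP; split; lra.
Qed.

(** Once the solutions agree at s, the estimate bounds their later difference by a multiple of
    zero. *)
Lemma solution_unique {x X Y} : is_solution S f x X -> is_solution S f x Y ->
  forall t, 0 <= t -> X t = Y t.
Proof.
move=> solX solY; apply: local_real_induction => [|t t0].
  by case: solX solY => -> _ _ _ [-> _ _ _].
have [r [e [r0 e0 est]]] := estimate_along_solution solX t0.
exists e => // s s' s0 tes ss' ste XYs.
have := est _ _ s0 tes ss' ste _ _ _ _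
  (solution_shift solX s0) (solution_shift solY s0).
rewrite -XYs !subrr normr0 mulr0 subr0 [s + _]addrC subrK => /(_ r0 r0).
by rewrite normr_le0 subr_eq0 => /eqP.
Qed.

(** One step enlarges differences by a factor at most 3/2. The property propagated in time
    quantifies over all tolerances, so it can be used at s with a smaller one. *)
Lemma continuous_dependence {x X t} : is_solution S f x X -> 0 <= t ->
  forall eps : R, 0 < eps -> exists2 d : R, 0 < d &
    forall y Y, is_solution S f y Y -> `|y - x| < d ->
      forall u, 0 <= u <= t -> `|Y u - X u| < eps.
Proof.
move=> solX; move: t; apply: local_real_induction => [eps eps0|t t0].
  exists eps => // y Y [Y0 _ _ _] yx u; rewrite -eq_le => /eqP <-.
  by case: solX => -> _ _ _; rewrite Y0.
have [r [e [r0 e0 est]]] := estimate_along_solution solX t0.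
exists e => // s s' s0 tes ss' ste Ps eps eps0.
(* The factor 3/2 turns eps / 2 into less than eps; r keeps [Y s] where the estimate applies. *)
have [|d d0 dP] := Ps (Num.min (eps / 2) r).
  by rewrite lt_min r0 andbT; lra.
exists d => // y Y solY yx u /andP[u0 us'].
have dPs v : 0 <= v <= s -> `|Y v - X v| < eps / 2 /\ `|Y v - X v| < r.
  by move=> vs; have := dP _ _ solY yx _ vs; rewrite lt_min => /andP[].
have [us|su] := leP u s.
  by have [|] := dPs u; rewrite ?u0 //; lra.
have [|Ys Yr] := dPs s; first by rewrite s0 lexx.
have := est s u s0 tes (ltW su) (le_lt_trans us' ste) _ _ _ _
  (solution_shift solY s0) (solution_shift solX s0) Yr.
rewrite subrr normr0 => /(_ r0); rewrite [s + _]addrC subrK.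
have := ler_normD ((Y u - X u) - (Y s - X s)) (Y s - X s); rewrite subrK.
lra.
Qed.

Hypothesis f_complete : forward_complete S f.

Lemma flow_is_solution {x} : S x ->
  is_solution S f x (fun t => flow S f t x).
Proof.
by move=> Sx; have /getPex := f_complete _ Sx.
Qed.

Lemma flow_unique {x X t} : is_solution S f x X -> 0 <= t ->
  flow S f t x = X t.
Proof.
move=> solX t0; have [X0 SX _ _] := solX.
have Sx : S x by rewrite -X0; exact: SX.
exact: (solution_unique (flow_is_solution Sx) solX).
Qed.

Context {Omega : set 'cV[R]_n}.
Hypothesis Omega_sub : Omega `<=` S.
Hypothesis Omega_inv : positively_invariant S f Omega.

(** Around q, the position at time s, a small ball lies in [Omega]. Its image under the flow for
    time s' - s contains a ball around the position at s', and lies in [Omega] by invariance. *)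
Lemma interior_positively_invariant : positively_invariant S f Omega°.
Proof.
move=> x t Ox; move: t.
have Sx : S x := Omega_sub _ (interior_subset Ox).
have solX := flow_is_solution Sx; have [X0 SX _ _] := solX.
apply: local_real_induction => [|t t0]; first by rewrite X0.
have [r [e [r0 e0 est]]] := estimate_along_solution solX t0.
exists e => // s s' s0 tes ss' ste.
have ss0 : 0 <= s' - s by rewrite subr_ge0.
set q := flow S f s x => /nbhs_ballP[r' /= r'0 Or'].
(* Halving lets the closed ball of radius d fit inside both open balls. *)
pose d := Num.min (r / 2) (r' / 2).
have [d0 dr dr'] : [/\ 0 < d, d < r & d < r'].
  by rewrite lt_min !gt_min; split; [apply/andP; split|apply/orP; left|apply/orP; right]; lra.
have Od z : `|z - q| <= d -> Omega z.
  by move=> zq; apply: Or'; rewrite -ball_normE /ball_ /= distrC; exact: le_lt_trans zq _.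
have qE : flow S f s' x = flow S f (s' - s) q.
  rewrite (flow_unique (solution_shift solX s0) ss0) [s + _]addrC subrK //.
rewrite qE; apply/nbhs_ballP; exists (d / 2) => /=; first by lra.
move=> y; rewrite -ball_normE /ball_ /= distrC => /ltW yd.
have [|z zd <-] := perturbed_id_surjective d0 _ yd.
  move=> z z' zd z'd; apply: (est s s' s0 tes ss' ste _ _
    (fun u => flow S f u z) (fun u => flow S f u z')).
  - exact: flow_is_solution (Omega_sub _ (Od _ zd)).
  - exact: flow_is_solution (Omega_sub _ (Od _ z'd)).
  - exact: le_lt_trans zd dr.
  - exact: le_lt_trans z'd dr.
by apply: Omega_inv => //; exact: Od.
Qed.
End flow_properties.

(** * The chain rule from continuous partial derivatives *)

Lemma mean_value_from0 {R : realType} {g dg : R -> R} {b : R} :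
  (forall s, `|s| <= `|b| -> is_derive s (1 : R) g (dg s)) ->
  exists2 c, `|c| <= `|b| & g b - g 0 = dg c * b.
Proof.
move=> dgP; have [b0|/ltW b0] := leP 0 b.
- have sub s : s \in `[0, b] -> `|s| <= `|b|.
    by rewrite in_itv /= => /andP[s0 sb]; rewrite !ger0_norm.
  have [|| c cb gE] := MVT_segment (f := g) (df := dg) b0.
  + by move=> s sb; apply: dgP; apply: sub; apply: subset_itv_oo_cc sb.
  + by apply: derivable_within_continuous => s /sub /dgP [].
  by exists c; [exact: sub|rewrite gE subr0].
- have sub s : s \in `[b, 0] -> `|s| <= `|b|.
    by rewrite in_itv /= => /andP[bs s0]; rewrite !ler0_norm// lerN2.
  have [|| c cb gE] := MVT_segment (f := g) (df := dg) b0.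
  + by move=> s sb; apply: dgP; apply: sub; apply: subset_itv_oo_cc sb.
  + by apply: derivable_within_continuous => s /sub /dgP [].
  exists c; first exact: sub.
  by rewrite -[LHS]opprB gE sub0r mulrN opprK.
Qed.

Lemma is_derive_line {R : realType} {U V : normedModType R} {g : U -> V}
    {y e : U} {s : R} {d : V} :
  is_derive (y + s *: e) e g d ->
  is_derive s (1 : R) (fun t => g (y + t *: e)) d.
Proof.
move=> [dg eg].
have quot : (fun h : R => h^-1 *: (g (y + (h *: (1 : R) + s) *: e) - g (y + s *: e)))
    = (fun h => h^-1 *: (g (h *: e + (y + s *: e)) - g (y + s *: e))).
  by apply/funext => h; rewrite [h *: 1]mulr1 scalerDl addrCA.
apply: DeriveDef; first by rewrite /derivable quot.
by rewrite -eg /derive quot.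
Qed.

Lemma mulmx00_norm_le {R : realType} {n : nat} (a : 'rV[R]_n) (u : 'cV[R]_n) :
  `|(a *m u) 0 0| <= n%:R * `|a| * `|u|.
Proof.
rewrite mxE; apply: le_trans (ler_norm_sum _ _ _) _.
rewrite -mulrA mulr_natl.
have -> : `|a| * `|u| *+ n = \sum_(i < n) `|a| * `|u|.
  by rewrite sumr_const card_ord.
apply: ler_sum => i _; rewrite normrM.
by apply: ler_pM; rewrite ?coord_le_mx_norm.
Qed.

Section continuously_differentiable.
Context {R : realType} {n : nat} {A : set 'cV[R]_n} {V : 'cV[R]_n -> R}.
Context {G : 'cV[R]_n -> 'rV[R]_n}.
Hypothesis gradV : is_gradient A V G.
Implicit Types (x w : 'cV[R]_n).

(** These truncations lead from 0 to w, each step moving along one coordinate axis, where a partial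
    derivative controls [V]. *)
Let head w (k : nat) : 'cV[R]_n := \col_i (if (i < k)%N then w i 0 else 0).

(** Total differentiability from continuous partial derivatives: the increment of [V] telescopes
    over the truncations of w, and the mean value theorem treats each axis. *)
Lemma gradient_increment {x} : A° x -> forall eps : R, 0 < eps ->
  exists2 d : R, 0 < d & forall w, `|w| < d ->
    `|V (x + w) - V x - (G x *m w) 0 0| <= eps * `|w|.
Proof.
move=> Ax eps eps0; have [dV cG] := gradV.
have /nbhs_ballP[d1 /= d10 d1A] : nbhs x A°.
  by move: (open_interior A); rewrite openE; apply.
(* There are n errors to sum; dividing by n + 1 also covers n = 0. *)
have eps'0 : 0 < eps / n.+1%:R by rewrite divr_gt0.
move/within_continuousP/(_ x (interior_subset Ax) _ eps'0) : cG => [d2 d20 d2G].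
exists (Num.min d1 d2); first by rewrite lt_min d10.
move=> w; rewrite lt_min => /andP[w1 w2].
have near_x v : `|v| <= `|w| -> A° (x + v) /\ `|G (x + v) - G x| < eps / n.+1%:R.
  move=> vw; have Axv : A° (x + v).
    apply: d1A; rewrite -ball_normE /ball_ /= opprD addNKr normrN.
    exact: le_lt_trans w1.
  split => //; apply: d2G; first exact: interior_subset.
  by rewrite addrC addKr; exact: le_lt_trans w2.
suff : forall k, (k <= n)%N ->
    `|V (x + head w k) - V x - (G x *m head w k) 0 0|
      <= k%:R * (eps / n.+1%:R * `|w|).
  move=> /(_ n (leqnn n)); have -> : head w n = w.
    by apply/matrixP => i j; rewrite !mxE ltn_ord ord1.
  move=> /le_trans; apply; rewrite mulrA ler_wpM2r// mulrCA ger_pMr//.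
  by rewrite ler_pdivrMr// mul1r ler_nat.
elim=> [_|k IH kn].
  have -> : head w 0 = 0 by apply/matrixP => i j; rewrite !mxE ltn0.
  by rewrite addr0 subrr mulmx0 mxE subr0 normr0 mul0r.
pose i := Ordinal kn; pose e : 'cV[R]_n := delta_mx i 0.
have headS : head w k.+1 = head w k + w i 0 *: e.
  apply/matrixP => j l; rewrite !mxE ord1 eqxx andbT ltnS leq_eqVlt.
  have [->|ji] := eqVneq j i; first by rewrite eqxx ltnn mulr1 add0r.
  by rewrite -val_eqE /= in ji; rewrite (negbTE ji) mulr0 addr0.
(* In the sup norm the intermediate points are no longer than w, so [near_x] applies to them. *)
have small c : `|c| <= `|w i 0| -> `|head w k + c *: e| <= `|w|.
  move=> cw; apply: mx_norm_le => // j l; rewrite !mxE ord1 eqxx andbT.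
  have [->|ji] := eqVneq j i.
    by rewrite ltnn mulr1 add0r; exact: le_trans cw (coord_le_mx_norm _ _ _).
  rewrite mulr0 addr0; case: ifP => _; last by rewrite normr0.
  exact: coord_le_mx_norm.
have dline c : `|c| <= `|w i 0| -> is_derive c (1 : R)
    (fun s => V (x + head w k + s *: e)) (G (x + head w k + c *: e) 0 i).
  by move=> cw; apply/is_derive_line/dV; rewrite -addrA; case: (near_x _ (small _ cw)).
have [c cw VE] := mean_value_from0 dline.
rewrite scale0r addr0 -!addrA -headS in VE.
have [_ Gc] := near_x _ (small c cw).
have GE : (G x *m head w k.+1) 0 0 = (G x *m head w k) 0 0 + G x 0 i * w i 0.
  by rewrite headS mulmxDr -scalemxAr -colE !mxE [w i 0 * _]mulrC.
have -> : V (x + head w k.+1) - V x - (G x *m head w k.+1) 0 0 =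
    (V (x + head w k) - V x - (G x *m head w k) 0 0) +
    (G (x + (head w k + c *: e)) 0 i - G x 0 i) * w i 0.
  by rewrite GE mulrBl; lra.
apply: le_trans (ler_normD _ _) _; rewrite -[k.+1%:R]natr1 [in leRHS]mulrDl mul1r.
apply: lerD; first exact: IH (ltnW kn).
rewrite normrM; apply: ler_pM => //; last exact: coord_le_mx_norm.
apply: le_trans (ltW Gc).
by have := coord_le_mx_norm (G (x + (head w k + c *: e)) - G x) 0 i; rewrite !mxE.
Qed.

Lemma gradient_continuous {x} : A° x -> forall eps : R, 0 < eps ->
  exists2 d : R, 0 < d & forall y, `|y - x| < d -> `|V y - V x| < eps.
Proof.
move=> Ax eps eps0; have [d d0 dV] := gradient_increment Ax _ ltr01.
(* The linear part contributes [n%:R * |G x|], the differentiability error, taken with factor 1, the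
   rest. *)
pose K := n%:R * `|G x| + 1; have K0 : 0 < K by rewrite ltr_wpDl// mulr_ge0.
exists (Num.min d (eps / K)); first by rewrite lt_min d0 divr_gt0.
move=> y; rewrite lt_min ltr_pdivlMr// => /andP[yd yK].
have := dV _ yd; rewrite [x + _]addrC subrK => incr.
have := mulmx00_norm_le (G x) (y - x).
rewrite -[V y - V x](subrK ((G x *m (y - x)) 0 0)).
move=> Gxy; apply: le_lt_trans (ler_normD _ _) _; move: Gxy incr.
by move: yK; rewrite /K mulrDr mulr1 [`|_| * (_ * _)]mulrC; lra.
Qed.

Lemma gradient_chain {X : R -> 'cV[R]_n} {t : R} {v : 'cV[R]_n} :
  is_derive t (1 : R) X v -> A° (X t) ->
  is_derive t (1 : R) (V \o X) ((G (X t) *m v) 0 0).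
Proof.
move=> [dX eX] AXt.
suff lim_quot : h^-1 *: (V (X (h *: (1 : R) + t)) - V (X t)) @[h --> 0^'] -->
    (G (X t) *m v) 0 0.
  by apply: DeriveDef; [exact: cvgP lim_quot|exact: cvg_lim lim_quot].
apply/cvgrPdist_le => eps eps0.
pose K := n%:R * `|G (X t)| + 1.
have K0 : 0 < K by rewrite ltr_wpDl// mulr_ge0.
(* The bound 1 keeps the quotient of [X] below [|v| + 1] in norm; the other gives the linear part
   half of the error. *)
pose r := Num.min 1 (eps / 2 / K).
have r0 : 0 < r by rewrite lt_min ltr01 !divr_gt0.
have rK : r * K <= eps / 2 by rewrite -ler_pdivlMr// ge_min lexx orbT.
have r1 : r <= 1 by rewrite ge_min lexx.
(* The differentiability error of [V] takes the other half. *)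
pose eps' := eps / 2 / (`|v| + 1).
have v1 : 0 < `|v| + 1 by rewrite ltr_wpDl.
have eps'0 : 0 < eps' by rewrite !divr_gt0.
have eps'E : eps' * (`|v| + 1) = eps / 2 by rewrite divfK// gt_eqF.
have [d d0 dV] := gradient_increment AXt _ eps'0.
near=> h.
have h0 : h != 0 by near: h; exact: nbhs_dnbhs_neq.
set w := X (h *: (1 : R) + t) - X t.
have qv : `|h^-1 *: w - v| < r.
  rewrite distrC /w; near: h.
  have : h^-1 *: (X (h *: (1 : R) + t) - X t) @[h --> 0^'] --> v.
    by rewrite -eX; exact: dX.
  by move=> /cvgrPdist_lt; apply.
have qle : `|h^-1 *: w| <= `|v| + 1.
  by have := ler_normD (h^-1 *: w - v) v; rewrite subrK; lra.
have wd : `|w| < d.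
  rewrite -[w]scale1r -(mulfV h0) -scalerA normrZ.
  apply: (@le_lt_trans _ _ (`|h| * (`|v| + 1))); first by rewrite ler_wpM2l.
  by rewrite -ltr_pdivlMr//; near: h; apply: dnbhs0_lt; exact: divr_gt0.
have := dV _ wd; rewrite [X t + _]addrC subrK => incr.
have h1 : 0 < `|h^-1| by rewrite normr_gt0 invr_eq0.
have incr' : `|h^-1 * (V (X (h *: 1 + t)) - V (X t)) - (G (X t) *m (h^-1 *: w)) 0 0|
    <= eps' * `|h^-1 *: w|.
  by rewrite -scalemxAr [in leLHS]mxE -mulrBr normrM normrZ mulrCA ler_pM2l.
have Gq : `|(G (X t) *m (h^-1 *: w)) 0 0 - (G (X t) *m v) 0 0|
    <= n%:R * `|G (X t)| * `|h^-1 *: w - v|.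
  by have := mulmx00_norm_le (G (X t)) (h^-1 *: w - v); rewrite mulmxBr !mxE.
have : eps' * `|h^-1 *: w| <= eps / 2 by rewrite -eps'E ler_pM2l.
have : n%:R * `|G (X t)| * `|h^-1 *: w - v| <= eps / 2.
  apply: le_trans rK; rewrite mulrC; apply: ler_pM; rewrite ?(ltW qv) ?mulr_ge0//.
  by rewrite /K; lra.
rewrite -[h^-1 *: (V _ - V _)]/(h^-1 * (V (X (h *: 1 + t)) - V (X t))).
move: incr' Gq; set q := h^-1 * _; set p := (_ *m (_ *: _)) 0 0.
set g := (_ *m v) 0 0; have := ler_distD p q g; rewrite (distrC g); lra.
Unshelve. all: by end_near. Qed.

Lemma decrease_along_solution {S : set 'cV[R]_n} {f : 'cV[R]_n -> 'cV[R]_n}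
    {x : 'cV[R]_n} {X : R -> 'cV[R]_n} {a b c : R} :
  is_solution S f x X -> 0 <= a -> a <= b ->
  (forall t, a <= t <= b -> A° (X t)) ->
  (forall t, a <= t <= b -> (G (X t) *m f (X t)) 0 0 <= - c) ->
  V (X b) <= V (X a) - c * (b - a).
Proof.
move=> solX a0 ab AX Gc; have [_ _ _ dX] := solX.
have [||t tab VE] := @MVT_segment _ (V \o X) (fun t => (G (X t) *m f (X t)) 0 0) _ _ ab.
- move=> t; rewrite in_itv /= => /andP[at_ tb].
  apply: gradient_chain; first by apply: dX; exact: le_lt_trans at_.
  by apply: AX; rewrite !ltW.
(* The endpoint a may be 0, where [X] has only a one-sided derivative, so continuity comes by
   composition and not from the chain rule. *)
- apply/within_continuousP => t tab eps eps0.
  have tab' : a <= t <= b by move: tab; rewrite /= in_itv.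
  have [d1 d10 Vd] := gradient_continuous (AX _ tab') _ eps0.
  have t0 : 0 <= t by case/andP: tab' => at_ _; exact: le_trans at_.
  have /within_continuousP/(_ t) := solution_continuous solX.
  rewrite /= in_itv /= andbT => /(_ t0 _ d10)[d d0 Xd].
  exists d => // s; rewrite /= !in_itv /= => /andP[as_ _] sd.
  by apply: Vd; apply: Xd => //; rewrite /= in_itv /= andbT; exact: le_trans as_.
have tab' : a <= t <= b by move: tab; rewrite in_itv.
have : (G (X t) *m f (X t)) 0 0 * (b - a) <= - c * (b - a).
  by apply: ler_wpM2r (Gc _ tab'); rewrite subr_ge0.
by move: VE => /=; lra.
Qed.
End continuously_differentiable.

(** * Output stability *)

Lemma enorm0 {R : realType} {n : nat} : enorm (0 : 'cV[R]_n) = 0.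
Proof.
rewrite /enorm big1 ?sqrtr0// => i _.
by rewrite mxE expr0n.
Qed.

Lemma norm_le_enorm {R : realType} {n : nat} (x : 'cV[R]_n) : `|x| <= enorm x.
Proof.
apply: mx_norm_le => [|i j]; first exact: sqrtr_ge0.
rewrite ord1 -sqrtr_sqr /enorm ler_sqrt; last by apply: sumr_ge0 => k _; exact: sqr_ge0.
by rewrite (bigD1 i)//= lerDl sumr_ge0// => k _; exact: sqr_ge0.
Qed.

Lemma enorm_continuous {R : realType} {n : nat} : continuous (@enorm R n).
Proof.
have sum_cont : continuous (fun x : 'cV[R]_n => \sum_(i < n) x i 0 ^+ 2).
  apply: (continuous_big add_continuous) => i _ x.
  apply: (@continuous_comp _ _ _ (fun x : 'cV[R]_n => x i 0) (fun z => z ^+ 2)).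
    exact: coord_continuous.
  exact: exprn_continuous.
move=> x; apply: (@continuous_comp _ _ _ _ Num.sqrt); first exact: sum_cont.
exact: sqrt_continuous.
Qed.

Lemma enorm_within_continuous {R : realType} {n k : nat} {S : set 'cV[R]_n}
    {h : 'cV[R]_n -> 'cV[R]_k} : {within S, continuous h} ->
  {within S, continuous (fun x => enorm (h x))}.
Proof.
move=> ch x; apply: (@continuous_comp (subspace S) _ _ h (@enorm R k)).
  exact: ch.
exact: enorm_continuous.
Qed.

Lemma constant_solution {R : realType} {n : nat} {S : set 'cV[R]_n}
    {f : 'cV[R]_n -> 'cV[R]_n} {x : 'cV[R]_n} :
  S x -> f x = 0 -> is_solution S f x (fun=> x).
Proof.
move=> Sx fx; split => // [|t t0]; rewrite fx.
  under eq_fun do rewrite subrr scaler0.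
  exact: cvg_cst.
exact: is_derive_cst.
Qed.

Lemma Kinfty_reflects_le {R : realType} {a : R -> R} {s t : R} :
  class_Kinfty a -> 0 <= s -> 0 <= t -> a s <= a t -> s <= t.
Proof.
move=> [_ a_mono _ _] s0 t0; apply: contraTT; rewrite -!ltNge => ts.
by apply: a_mono => //; rewrite in_itv /= andbT.
Qed.

Section output_stability.
Context {R : realType} {n k : nat} {S : set 'cV[R]_n}.
Context {f : 'cV[R]_n -> 'cV[R]_n} {h : 'cV[R]_n -> 'cV[R]_k}.
Context {Omega : set 'cV[R]_n}.
Hypothesis f_lip : [locally [lipschitz f x | x in S]].
Hypothesis h_cont : {within S, continuous h}.
Hypothesis f_complete : forward_complete S f.
Hypothesis Omega_sub : Omega `<=` S.

(** If the output from x exceeded c at time t, so would the output from interior points close enough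
    to x. Such points exist by density, and lie in the ball because it is open. *)
Lemma output_bound_from_interior {r t c : R} {x : 'cV[R]_n} :
  between_open_and_closure Omega -> 0 <= t -> (eball r `&` Omega) x ->
  (forall z, (eball r `&` Omega°) z -> enorm (output S f h t z) <= c) ->
  enorm (output S f h t x) <= c.
Proof.
move=> [U [oU UO OU]] t0 [xr Ox] bound; rewrite leNgt; apply/negP => c_lt.
have solX := flow_is_solution f_complete (Omega_sub _ Ox).
have [_ SX _ _] := solX.
have gap0 : 0 < enorm (output S f h t x) - c by rewrite subr_gt0.
have /within_continuousP/(_ _ (SX t t0) _ gap0)[d1 d10 hd] :=
  enorm_within_continuous h_cont.
have [d2 d20 Xd] := continuous_dependence f_lip solX t0 _ d10.
have /cvgrPdist_lt/(_ (r - enorm x)) := @enorm_continuous R n x.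
rewrite subr_gt0 => /(_ xr) /nbhs_ballP[d3 /= d30 rd].
have [|z [Uz]] := OU _ Ox (ball x (Num.min d2 d3)).
  by apply: nbhsx_ballx; rewrite lt_min d20.
rewrite -ball_normE /ball_ /= lt_min => /andP[xz2 xz3].
have Oz : Omega° z by move: UO; rewrite open_subsetE// => /(_ _ Uz).
have zr : eball r z.
  have := rd z; rewrite -ball_normE /ball_ /= => /(_ xz3).
  by rewrite /eball /= ltr_norml => /andP[]; lra.
have := bound z (conj zr Oz).
have Sz : S z := Omega_sub _ (UO _ Uz).
have solZ := flow_is_solution f_complete Sz; have [_ SZ _ _] := solZ.
have := Xd _ _ solZ; rewrite distrC => /(_ xz2 t); rewrite t0 lexx => /(_ isT).
move=> /(hd _ (SZ t t0)); rewrite /output ltr_norml => /andP[]; lra.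
Qed.

(** * Decay of [W] and [V] along interior trajectories *)

Hypothesis Omega_inv : positively_invariant S f Omega.
Context {a rho : R -> R} {V W : 'cV[R]_n -> R} {GV GW : 'cV[R]_n -> 'rV[R]_n}.
Hypothesis a_Kinfty : class_Kinfty a.
Hypothesis gradV : is_gradient Omega V GV.
Hypothesis gradW : is_gradient Omega W GW.
Hypothesis V_ge0 : forall x, Omega x -> 0 <= V x.
Hypothesis rho_cont : {within `[0, +oo[, continuous rho}.
Hypothesis rho_pd : positive_definite rho.
Hypothesis V_decr : forall x, Omega x -> (GV x *m f x) 0 0 <= - rho (W x).
Hypothesis W_bound : forall x, Omega x -> a (enorm (h x)) <= W x.
Hypothesis W_decr : forall x, Omega x -> (GW x *m f x) 0 0 <= 0.

Lemma interior_solution {x : 'cV[R]_n} : Omega° x ->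
  is_solution S f x (fun t => flow S f t x) /\
  forall t, 0 <= t -> Omega° (flow S f t x).
Proof.
move=> Ox; split; first exact (flow_is_solution f_complete (Omega_sub _ (interior_subset Ox))).
move=> t t0.
exact: (interior_positively_invariant f_lip f_complete Omega_sub Omega_inv).
Qed.

Lemma W_nonincreasing {x : 'cV[R]_n} {s t : R} : Omega° x -> 0 <= s -> s <= t ->
  W (flow S f t x) <= W (flow S f s x).
Proof.
move=> /interior_solution[solX OX] s0 st.
have := @decrease_along_solution _ _ _ _ _ gradW _ _ _ _ s t 0 solX s0 st.
rewrite mul0r subr0; apply=> u /andP[su _].
  exact: OX (le_trans s0 su).
by rewrite oppr0; apply: W_decr; exact: interior_subset (OX _ (le_trans s0 su)).
Qed.

Lemma interior_output_bound {c N t : R} {x : 'cV[R]_n} : Omega° x -> 0 <= t ->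
  0 <= N -> W x <= c -> c <= a N -> enorm (output S f h t x) <= N.
Proof.
move=> Ox t0 N0 Wc cN; have [solX OX] := interior_solution Ox.
have [X0 _ _ _] := solX.
apply: (Kinfty_reflects_le a_Kinfty) => //; first exact: sqrtr_ge0.
apply: le_trans (W_bound _ (interior_subset (OX t t0))) _.
apply: le_trans cN; apply: le_trans Wc.
by rewrite -[in leRHS]X0; exact: W_nonincreasing.
Qed.

(* While W > a eps, V decreases at a rate bounded below by the minimum of rho
   on [a eps, c], so this lasts for a time at most c divided by that rate. *)
Lemma interior_attractivity {eps c : R} : 0 < eps -> exists2 T : R, 0 < T &
  forall x t, Omega° x -> V x <= c -> W x <= c -> T <= t ->
    enorm (output S f h t x) <= eps.
Proof.
move=> eps0; have [_ a_mono a0 _] := a_Kinfty.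
have aeps0 : 0 < a eps.
  by rewrite -[ltLHS]a0; apply: a_mono => //; rewrite in_itv /= andbT ?lexx// ltW.
(* The maximum keeps the interval from [a eps] to [M] nonempty even if c is below [a eps]. *)
pose M := Num.max c (a eps).
have [||m mM rho_m] := @EVT_min R rho (a eps) M.
- by rewrite le_max lexx orbT.
- move: rho_cont; apply: continuous_subspaceW => s; rewrite /= !in_itv /= andbT.
  by move=> /andP[+ _]; apply: le_trans; exact: ltW.
have m0 : 0 < m by move: mM; rewrite in_itv /= => /andP[+ _]; exact: lt_le_trans.
have rm0 : 0 < rho m by apply: (rho_pd.2).
have M0 : 0 < M by rewrite lt_max aeps0 orbT.
(* Over this time [V] would drop by at least M + 1, more than its initial bound c, and become
   negative. *)
exists ((M + 1) / rho m); first by rewrite divr_gt0// ltr_wpDl// ltW.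
move=> x t Ox Vc Wc Tt.
have t0 : 0 <= t by apply: le_trans Tt; rewrite ltW// divr_gt0// ltr_wpDl// ltW.
have [solX OX] := interior_solution Ox; have [X0 _ _ _] := solX.
apply: (Kinfty_reflects_le a_Kinfty) => //; [exact: sqrtr_ge0|exact: ltW|].
apply: le_trans (W_bound _ (interior_subset (OX t t0))) _.
rewrite leNgt; apply/negP => Wt.
have := @decrease_along_solution _ _ _ _ _ gradV _ _ _ _ 0 t (rho m) solX (lexx 0) t0.
have Xt u : 0 <= u <= t -> Omega° (flow S f u x).
  by move=> /andP[u0 _]; exact: OX.
move=> /(_ Xt); rewrite X0 subr0.
have rate u : 0 <= u <= t ->
    (GV (flow S f u x) *m f (flow S f u x)) 0 0 <= - rho m.
  move=> utt; apply: le_trans (V_decr _ (interior_subset (Xt u utt))) _.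
  (* Monotonicity of [W] confines its values on the whole time interval between [a eps] and [M]. *)
  case/andP: utt => u0 ut; rewrite lerN2; apply: rho_m; rewrite in_itv /=.
  have Wtu := W_nonincreasing Ox u0 ut.
  have := W_nonincreasing Ox (lexx 0) u0; rewrite X0 => Wu0.
  by rewrite (le_trans (ltW Wt) Wtu) le_max (le_trans Wu0 Wc).
move=> /(_ rate); move: Tt; rewrite ler_pdivrMr// [rho m * t]mulrC.
have := V_ge0 _ (interior_subset (OX t t0)).
have : c <= M by rewrite le_max lexx.
lra.
Qed.
End output_stability.

(** * Uniform asymptotic output stability *)

Theorem theorem1 (R : realType) (n k : nat)
  (S : set 'cV[R]_n) (f : 'cV[R]_n -> 'cV[R]_n) (h : 'cV[R]_n -> 'cV[R]_k)
  (Omega : set 'cV[R]_n)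
  (a rho : R -> R) (V W : 'cV[R]_n -> R)
  (S0 : S 0)
  (f_lip : [locally [lipschitz f x | x in S]]) (f0 : f 0 = 0)
  (h_cont : {within S, continuous h}) (h0 : h 0 = 0)
  (f_complete : forward_complete S f)
  (Omega_sub : Omega `<=` S)
  (Omega_inv : positively_invariant S f Omega)
  (Omega0 : Omega 0)
  (a_Kinfty : class_Kinfty a)
  (V_C1 : C1_nonneg Omega V) (W_C1 : C1_nonneg Omega W)
  (VW_sup : forall s : R, 0 <= s ->
     (ereal_sup [set (V x + W x)%:E | x in [set x | Omega x /\ (enorm x <= s)%R]]
        < +oo)%E)
  (rho_cont : {within `[0, +oo[, continuous rho})
  (rho_pd : positive_definite rho)
  (V_decr : forall x, Omega x ->
     (grad Omega V x *m f x) 0 0 <= - rho (W x))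
  (W_bound : forall x, Omega x -> a (enorm (h x)) <= W x)
  (W_decr : forall x, Omega x -> (grad Omega W x *m f x) 0 0 <= 0) :
  UAOS S f h Omega.
Proof.
have gradP U : C1_nonneg Omega U -> is_gradient Omega U (grad Omega U).
  by case=> _ _ /getPex.
have [between V_ge0 _] := V_C1; have [_ W_ge0 _] := W_C1.
have gradV := gradP _ V_C1; have gradW := gradP _ W_C1.
have VW_bound r : 0 < r -> exists c : R, forall x, (eball r `&` Omega) x ->
    V x <= c /\ W x <= c.
  move=> r0; have := VW_sup _ (ltW r0); set E := [set _ | _ in _] => supE.
  have [c Ec] : exists c : R, forall v : R, E v%:E -> v <= c.
    (* A supremum equal to minus infinity leaves no real element in [E], so 0 is a vacuous bound. *)
    case: (ereal_sup E) supE (@ereal_sup_ubound _ E) => [c|//|] _ ubE.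
      by exists c => v /ubE; rewrite lee_fin.
    by exists 0 => v /ubE.
  exists c => x [xr Ox].
  have EVW : E (V x + W x)%:E by exists x => //; split => //; exact: ltW.
  (* Nonnegativity of both functions lets the bound on the sum bound each of them. *)
  by have := Ec _ EVW; have := V_ge0 _ Ox; have := W_ge0 _ Ox; lra.
have attractive eps r : 0 < eps -> 0 < r -> exists2 T : R, 0 < T &
    forall x0 t, (eball r `&` Omega) x0 -> T <= t ->
      enorm (output S f h t x0) <= eps.
  move=> eps0 r0; have [c VWc] := VW_bound r r0.
  have [T T0 HT] := interior_attractivity f_lip f_complete Omega_sub Omega_inv
    a_Kinfty gradV gradW V_ge0 rho_cont rho_pd V_decr W_bound W_decr (c := c) eps0.
  exists T => // x t xO Tt; have t0 : 0 <= t by exact: le_trans (ltW T0) Tt.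
  apply: (output_bound_from_interior f_lip h_cont f_complete Omega_sub between t0 xO).
  move=> z [zr Oz]; have [Vz Wz] := VWc z (conj zr (interior_subset Oz)).
  exact: HT.
split => //.
- move=> r r0; have [c VWc] := VW_bound r r0.
  have [_ _ _ /cvgryPgt/(_ c) a_gt] := a_Kinfty.
  near (pinfty_nbhs R) => N.
  have N0 : 0 < N by near: N; exact: nbhs_pinfty_gt.
  have cN : c < a N by near: N.
  exists N; split; first exact: num_real.
  move=> B NB _ [x [t [xO t0 ->]]]; rewrite /= ger0_norm ?sqrtr_ge0//.
  apply: le_trans (ltW NB).
  apply: (output_bound_from_interior f_lip h_cont f_complete Omega_sub between t0 xO).
  move=> z [zr Oz]; have [_ Wz] := VWc z (conj zr (interior_subset Oz)).
  exact: (interior_output_bound f_lip f_complete Omega_sub Omega_inv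
    a_Kinfty gradW W_bound W_decr Oz t0 (ltW N0) Wz (ltW cN)).
(* Radius 1 is an arbitrary choice: attractivity settles times from [T] on, and comparison with the
   zero solution settles the times up to [T]. *)
- move=> eps eps0; have [T T0 HT] := attractive eps 1 eps0 ltr01.
  have /within_continuousP/(_ 0 S0 _ eps0)[d d0 hd] := enorm_within_continuous h_cont.
  have sol0 := constant_solution S0 f0.
  have [e e0 He] := continuous_dependence f_lip sol0 (ltW T0) _ d0.
  exists (Num.min e 1); first by rewrite lt_min e0 ltr01.
  move=> x t [xe Ox] t0; move: xe; rewrite /eball /= lt_min => /andP[xe x1].
  have [Tt|/ltW tT] := leP T t; first exact: HT.
  have solX := flow_is_solution f_complete (Omega_sub _ Ox); have [_ SX _ _] := solX.
  have := He _ _ solX; rewrite subr0 => /(_ (le_lt_trans (norm_le_enorm x) xe) t).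
  rewrite t0 tT => /(_ isT) /(hd _ (SX t t0)).
  rewrite h0 enorm0 subr0 => /ltW; apply: le_trans; exact: ler_norm.
Unshelve. all: by end_near. Qed.
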